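(* Let $n,N\ge 1$, let $\|\cdot\|$ be any norm on $\mathbb{R}^n$ with dual norm $\|\cdot\|_*$, let $\kappa>0$ and $\varepsilon\ge 0$, and let $(\hat x_i,\hat y_i)\in\Xi=\mathbb{R}^n\times\{-1,+1\}$, $i=1,\dots,N$, be given training data with empirical distribution $\hat{\mathbb{P}}_N$. Let $\mathbb{B}_\varepsilon(\hat{\mathbb{P}}_N)$ be the Wasserstein ball of radius $\varepsilon$ around $\hat{\mathbb{P}}_N$ with respect to the metric $d\big((x,y),(x',y')\big)=\|x-x'\|+\kappa|y-y'|/2$ on $\Xi$, and let $l_\beta(x,y)=\log(1+\exp(-y\langle\beta,x\rangle))$. Then the distributionally robust logistic regression problem $\inf_{\beta}\sup_{\mathbb{Q}\in\mathbb{B}_\varepsilon(\hat{\mathbb{P}}_N)}\mathbb{E}^{\mathbb{Q}}[l_\beta(x,y)]$ is equivalent to $$ \hat J:=\inf_{\beta\in\mathbb{R}^n}\ \sup_{\mathbb{Q}\in\mathbb{B}_\varepsilon(\hat{\mathbb{P}}_N)}\mathbb{E}^{\mathbb{Q}}\left[l_\beta(x,y)\right] =\left\{\begin{array}{cll} \min\limits_{\beta,\lambda,s_i} & \lambda\varepsilon+\frac1N\sum_{i=1}^N s_i & \\ \text{s.t.} & l_\beta(\hat x_i,\hat y_i)\le s_i & \forall i\le N\\ & l_\beta(\hat x_i,-\hat y_i)-\lambda\kappa\le s_i & \forall i\le N\\ & \|\beta\|_*\le\lambda, & \end{array}\right. $$ where the minimization is over $\beta\in\mathbb{R}^n$, $\lambda\in\mathbb{R}$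 and $s_1,\dots,s_N\in\mathbb{R}$.
   Context: $\langle\cdot,\cdot\rangle$ is the standard inner product on $\mathbb{R}^n$, and the dual norm is $\|\beta\|_*:=\sup_{\|\xi\|\le 1}\langle\beta,\xi\rangle$. The set $\Xi=\mathbb{R}^n\times\{-1,+1\}$ is the feature-label space. The empirical distribution is $\hat{\mathbb{P}}_N=\frac1N\sum_{i=1}^N\delta_{(\hat x_i,\hat y_i)}$, where $\delta_{(\hat x_i,\hat y_i)}$ is the Dirac point measure at $(\hat x_i,\hat y_i)$. Wasserstein distance: let $M(\Xi^2)$ be the set of probability distributions on $\Xi\times\Xi$. For probability distributions $\mathbb{P},\mathbb{Q}$ on $\Xi$, $$W(\mathbb{Q},\mathbb{P}):=\inf_{\Pi\in M(\Xi^2)}\left\{\int_{\Xi^2}d(\xi,\xi')\,\Pi(\mathrm{d}\xi,\mathrm{d}\xi')\ :\ \Pi(\mathrm{d}\xi,\Xi)=\mathbb{Q}(\mathrm{d}\xi),\ \Pi(\Xi,\mathrm{d}\xi')=\mathbb{P}(\mathrm{d}\xi')\right\},$$ where $\xi=(x,y)$. The Wasserstein ball is $\mathbb{B}_\varepsilon(\mathbb{P}):=\{\mathbb{Q}: W(\mathbb{Q},\mathbb{P})\le\varepsilon\}$, with $\mathbb{Q}$ ranging over probability distributions on $\Xi$.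
   Formalization: The equality holds for all ε ≥ 0 with ''min'' read as the optimal value (infimum); attainment of the minimum is stated only for ε > 0, since at ε = 0 it can fail (e.g. n = N = 1, x̂ = 1, ŷ = +1, where both sides are 0 but no feasible point has objective 0). *)

(* Defs.v *)
From HB Require Import structures.
From mathcomp Require Import all_boot all_order all_algebra.
From mathcomp Require Import all_classical all_reals all_analysis.

Set Implicit Arguments.
Unset Strict Implicit.
Unset Printing Implicit Defensive.

Import Order.TTheory GRing.Theory Num.Theory.
Import numFieldNormedType.Exports.

Local Open Scope classical_set_scope.
Local Open Scope ring_scope.

(* An arbitrary norm, as a bare function: 'rV[R]_n already carries the sup
   norm as canonical structure.  Nonnegativity follows from these axioms. *)
Record is_norm (R : realType) (n : nat) (nu : 'rV[R]_n -> R) : Prop := IsNorm {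
  norm_definite : forall x, nu x = 0 -> x = 0;
  norm_homogeneous : forall (a : R) x, nu (a *: x) = `|a| * nu x;
  norm_triangle : forall x y, nu (x + y) <= nu x + nu y
}.

Definition inner (R : realType) (n : nat) (u v : 'rV[R]_n) : R :=
  \sum_(j < n) u 0 j * v 0 j.

(* Extended-real valued, so that the supremum needs no boundedness proof. *)
Definition dual_norm (R : realType) (n : nat) (nu : 'rV[R]_n -> R)
    (b : 'rV[R]_n) : \bar R :=
  ereal_sup [set (inner b x)%:E | x in [set x | nu x <= 1]].

(* R^n with the Borel sigma-algebra of its usual topology (the one induced by
   any norm). *)
Definition Rn (R : realType) (n : nat) : Type :=
  g_sigma_algebraType (@open 'rV[R]_n).
HB.instance Definition _ R n := Measurable.on (Rn R n).

(* R^n x {-1, +1} with the product sigma-algebra.  The label set is encoded by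
   bool; [label] decodes it. *)
Definition Xi (R : realType) (n : nat) : Type := (Rn R n * bool)%type.
HB.instance Definition _ R n := Measurable.on (Xi R n).

Definition label (R : realType) (b : bool) : R := if b then 1 else -1.

Definition dist (R : realType) (n : nat) (nu : 'rV[R]_n -> R) (kappa : R)
    (z z' : Xi R n) : R :=
  nu ((z.1 : 'rV[R]_n) - z'.1) + kappa * `|label R z.2 - label R z'.2| / 2.

Definition is_coupling (R : realType) (n : nat) (Q P : probability (Xi R n) R)
    (Pi : probability (Xi R n * Xi R n)%type R) : Prop :=
  (forall A : set (Xi R n), measurable A -> Pi (A `*` setT) = Q A) /\
  (forall A : set (Xi R n), measurable A -> Pi (setT `*` A) = P A).

Definition wasserstein (R : realType) (n : nat) (nu : 'rV[R]_n -> R) (kappa : R)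
    (Q P : probability (Xi R n) R) : \bar R :=
  ereal_inf [set (\int[Pi]_w (dist nu kappa w.1 w.2)%:E)%E |
             Pi in [set Pi | is_coupling Q P Pi]].

Definition wasserstein_ball (R : realType) (n : nat) (nu : 'rV[R]_n -> R)
    (kappa eps : R) (P : probability (Xi R n) R) : set (probability (Xi R n) R) :=
  [set Q | (wasserstein nu kappa Q P <= eps%:E)%E].

Definition empirical (R : realType) (n N : nat) (z : 'I_N.+1 -> Xi R n)
    (A : set (Xi R n)) : \bar R :=
  ((N.+1%:R^-1)%:E * \sum_(i < N.+1) \d_(z i) A)%E.

Section empirical_probability.
Variables (R : realType) (n N : nat) (z : 'I_N.+1 -> Xi R n).

Let empiricalE : empirical z =
  mscale (N.+1%:R^-1)%:nng (msum (fun k => \d_(z (inord k))) N.+1).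
Proof.
apply/funext => A; rewrite /empirical /mscale /msum /=; congr (_ * _)%E.
by apply: eq_bigr => i _; rewrite inord_val.
Qed.

Let empirical0 : empirical z set0 = 0%E.
Proof. by rewrite empiricalE measure0. Qed.

Let empirical_ge0 A : (0 <= empirical z A)%E.
Proof. by rewrite empiricalE measure_ge0. Qed.

Let empirical_sigma_additive : semi_sigma_additive (empirical z).
Proof. by rewrite empiricalE; exact: measure_semi_sigma_additive. Qed.

HB.instance Definition _ := isMeasure.Build _ _ _ (empirical z)
  empirical0 empirical_ge0 empirical_sigma_additive.

Let empirical_setT : empirical z setT = 1%E.
Proof.
rewrite /empirical (eq_bigr (fun=> 1%E)) => [|i _]; last by rewrite diracT.
by rewrite sumEFin sumr_const card_ord -EFinM mulVf.
Qed.

HB.instance Definition _ :=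
  Measure_isProbability.Build _ _ _ (empirical z) empirical_setT.

End empirical_probability.

(* The label is a real number here, so that the loss at the opposite label
   reads [logloss b x (- y)]. *)
Definition logloss (R : realType) (n : nat) (b x : 'rV[R]_n) (y : R) : R :=
  ln (1 + expR (- y * inner b x)).

Definition worst_case_loss (R : realType) (n : nat) (nu : 'rV[R]_n -> R)
    (kappa eps : R) (P : probability (Xi R n) R) (b : 'rV[R]_n) : \bar R :=
  ereal_sup [set 'E_Q[fun w : Xi R n => logloss b w.1 (label R w.2)]%E |
             Q in wasserstein_ball nu kappa eps P].

(* A decision variable is a triple (beta, lambda, s). *)
Definition feasible (R : realType) (n N : nat) (nu : 'rV[R]_n -> R) (kappa : R)
    (z : 'I_N.+1 -> Xi R n) : set ('rV[R]_n * R * ('I_N.+1 -> R)) :=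
  [set p | let: (b, lam, s) := p in
    [/\ forall i, logloss b (z i).1 (label R (z i).2) <= s i,
        forall i, logloss b (z i).1 (- label R (z i).2) - lam * kappa <= s i
      & (dual_norm nu b <= lam%:E)%E]].

Definition objective (R : realType) (n N : nat) (eps : R)
    (p : 'rV[R]_n * R * ('I_N.+1 -> R)) : R :=
  let: (_, lam, s) := p in lam * eps + N.+1%:R^-1 * \sum_(i < N.+1) s i.

(* Main.v *)
(* Weak duality: the loss is lam-Lipschitz in the feature for every
   lam >= ||beta||_*, so l_beta(w) <= lam d(w, w') + max(l_beta(x', y'),
   l_beta(x', -y') - lam kappa); integrate against a nearly optimal coupling.

   Strong duality for fixed beta: eliminating s, the dual is a fractional
   knapsack problem in the flipping probabilities theta_i, with value density
   (l_beta(x_i, -y_i) - l_beta(x_i, y_i)) / kappa and the constraint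
   lam >= ||beta||_*.  Complementary slackness yields theta and lam; the
   distribution flipping the i-th label with probability theta_i, and spending
   what is left of the budget eps by sending a vanishing mass far away along a
   direction v with ||v|| <= 1 and <beta, v> close to ||beta||_*, has expected
   loss close to the dual value.

   Attainment for eps > 0: lam <= const / eps on the relevant sublevel set, so
   (beta, lam) ranges over a compact set.  For eps = 0 the minimum need not be
   attained, e.g. on separable data. *)
Require Import Defs.
From HB Require Import structures.
From mathcomp Require Import all_boot all_order all_algebra.
From mathcomp Require Import all_classical all_reals all_analysis.
From mathcomp Require Import measurable_realfun ring lra.

Set Implicit Arguments.
Unset Strict Implicit.
Unset Printing Implicit Defensive.

Import Order.TTheory GRing.Theory Num.Theory.
Import numFieldNormedType.Exports.

Local Open Scope classical_set_scope.
Local Open Scope ring_scope.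

(** * Inner product, equivalence of norms, and the dual norm *)

Section norm.
Variables (R : realType) (n : nat).
Implicit Types b u v x : 'rV[R]_n.+1.

Lemma innerDr b u v : inner b (u + v) = inner b u + inner b v.
Proof. by rewrite /inner -big_split; apply: eq_bigr => j _; rewrite mxE mulrDr. Qed.

Lemma innerZr b (a : R) u : inner b (a *: u) = a * inner b u.
Proof. by rewrite /inner mulr_sumr; apply: eq_bigr => j _; rewrite mxE mulrCA. Qed.

Lemma innerBr b u v : inner b (u - v) = inner b u - inner b v.
Proof. by rewrite innerDr -scaleN1r innerZr mulN1r. Qed.

Lemma inner0l u : inner 0 u = 0.
Proof. by rewrite /inner big1// => j _; rewrite mxE mul0r. Qed.

Lemma inner_delta b j : inner b (delta_mx 0 j) = b 0 j.
Proof.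
rewrite /inner (bigD1 j)//= mxE !eqxx mulr1 big1 ?addr0// => i ij.
by rewrite mxE (negbTE ij) andbF mulr0.
Qed.

Lemma continuous_innerr b : continuous (inner b).
Proof.
apply: continuous_big => [|j _ x]; first exact: add_continuous.
apply: (@continuous_comp _ _ _ (fun v : 'rV[R]_n.+1 => v 0 j) ( *%R (b 0 j))).
  exact: coord_continuous.
exact: mulrl_continuous.
Qed.

Lemma innerC b x : inner b x = inner x b.
Proof. by rewrite /inner; apply: eq_bigr => j _; rewrite mulrC. Qed.

Lemma continuous_innerl x : continuous (fun b => inner b x).
Proof.
rewrite (_ : (fun _ => _) = inner x); first exact: continuous_innerr.
by apply/funext => b; rewrite innerC.
Qed.

Lemma coord_le_norm x j : `|x 0 j| <= `|x|.
Proof.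
rewrite /Num.norm/= mx_normrE.
exact: (le_bigmax 0 (fun ij : 'I_1 * 'I_n.+1 => `|x ij.1 ij.2|) (0, j)).
Qed.

Variables (nu : 'rV[R]_n.+1 -> R) (Hnu : is_norm nu).

Lemma nu0 : nu 0 = 0.
Proof. by rewrite -(scale0r 0) (norm_homogeneous Hnu) normr0 mul0r. Qed.

Lemma nuN x : nu (- x) = nu x.
Proof. by rewrite -scaleN1r (norm_homogeneous Hnu) normrN1 mul1r. Qed.

Lemma nu_ge0 x : 0 <= nu x.
Proof.
have := norm_triangle Hnu x (- x); rewrite subrr nu0 nuN; lra.
Qed.

Lemma nu_gt0 x : x != 0 -> 0 < nu x.
Proof.
move=> x0; rewrite lt_neqAle nu_ge0 andbT eq_sym.
by apply: contra_neq x0; exact: norm_definite.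
Qed.

Lemma nu_delta_gt0 j : 0 < nu (delta_mx 0 j).
Proof.
apply: nu_gt0; apply/eqP => /matrixP/(_ 0 j); rewrite !mxE !eqxx => /eqP.
by rewrite oner_eq0.
Qed.

(** Adding the bounds at a basis vector and at its opposite cancels the inner products; the
    dimension is positive, so such a vector exists. *)
Lemma nu_bound_ge0 b (lam : R) : (forall x, inner b x <= lam * nu x) -> 0 <= lam.
Proof.
move=> blam; rewrite -(pmulr_lge0 _ (nu_delta_gt0 0)).
have := blam (delta_mx 0 0); have := blam (- delta_mx 0 0).
by rewrite nuN -scaleN1r innerZr; lra.
Qed.

(** Expand [x] in the standard basis and apply the triangle inequality; the summand 1 makes the
    constant visibly positive. *)
Lemma nu_le_norm : exists2 C, 0 < C & forall x, nu x <= C * `|x|.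
Proof.
exists (1 + \sum_j nu (delta_mx 0 j)) => [|x].
  by rewrite ltr_pwDl// sumr_ge0// => j _; exact: nu_ge0.
rewrite mulrDl mul1r mulr_suml {1}(row_sum_delta x).
apply: (@le_trans _ _ (\sum_j nu (delta_mx 0 j) * `|x|)); last by rewrite lerDr.
elim/big_ind2 : _ => [|a a' c c' ? ?|j _]; first by rewrite nu0.
  by apply: le_trans (norm_triangle Hnu _ _) _; exact: lerD.
by rewrite (norm_homogeneous Hnu) mulrC ler_wpM2l ?nu_ge0 ?coord_le_norm.
Qed.

Lemma continuous_nu : continuous nu.
Proof.
have [C C0 nuC] := nu_le_norm => x A /nbhs_ballP[e /= e0 eA].
apply/nbhs_ballP; exists (e / C) => [|y]; first exact: divr_gt0.
rewrite -ball_normE /= ltr_pdivlMr// mulrC => /(le_lt_trans (nuC _)) xye.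
apply: eA; rewrite -ball_normE /= ltr_norml; move: xye.
have := norm_triangle Hnu (x - y) y; rewrite subrK.
have := norm_triangle Hnu (y - x) x; rewrite subrK -(nuN (y - x)) opprB.
lra.
Qed.

(* nu attains a positive minimum on the unit sphere of the sup norm. *)
Lemma norm_le_nu : exists2 C, 0 < C & forall x, `|x| <= C * nu x.
Proof.
pose S := [set x : 'rV[R]_n.+1 | `|x| = 1].
have cS : compact S.
  apply: bounded_closed_compact.
    by exists 1; split => // M M1 x /= ->; exact: ltW.
  apply: (closed_comp (f := fun x : 'rV[R]_n.+1 => `|x|) (D := [set 1])).
    by move=> x _; exact: norm_continuous.
  exact: closed_eq.
have S0 : S !=set0.
  exists (const_mx 1); rewrite /S/=; apply/eqP; rewrite eq_le; apply/andP; split.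
    rewrite /Num.norm/= mx_normrE; apply/bigmax_leP; split=> // i _.
    by rewrite mxE normr1.
  by have := coord_le_norm (const_mx 1) 0; rewrite mxE normr1.
have [c] := compact_EVT_min S0 cS (continuous_subspaceT continuous_nu).
rewrite inE => Sc minc.
have nuc : 0 < nu c.
  by apply: nu_gt0; rewrite -normr_eq0 Sc oner_eq0.
exists (nu c)^-1 => [|x]; first by rewrite invr_gt0.
have [->|x0] := eqVneq x 0; first by rewrite normr0 nu0 mulr0.
have xn : 0 < `|x| by rewrite normr_gt0.
rewrite mulrC ler_pdivlMr//.
have : (`|x|^-1 *: x) \in S.
  by rewrite inE /S/= normrZ normfV normr_id mulVf// gt_eqF.
move=> /minc; rewrite (norm_homogeneous Hnu) normfV normr_id.
by rewrite ler_pdivlMl.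
Qed.

(** By equivalence of norms the unit ball of [nu] has bounded coordinates, which bounds the supremum
    above; [x = 0] bounds it below. *)
Lemma dual_norm_fin b : dual_norm nu b \is a fin_num.
Proof.
have [C C0 nuC] := norm_le_nu.
have bd x : nu x <= 1 -> inner b x <= \sum_j `|b 0 j| * C.
  move=> x1; apply: ler_sum => j _; apply: le_trans (ler_norm _) _.
  rewrite normrM ler_wpM2l// (le_trans (coord_le_norm _ _))//.
  by rewrite (le_trans (nuC _))// ler_piMr// ltW.
rewrite fin_real//; apply/andP; split.
  apply: (@lt_le_trans _ _ 0%E); first exact: ltNyr.
  apply: ereal_sup_ubound; exists 0 => /=; first by rewrite nu0.
  by rewrite innerC inner0l.
apply: le_lt_trans (ltry (\sum_j `|b 0 j| * C)).
by apply: ge_ereal_sup => _ [x /= x1 <-]; rewrite lee_fin bd.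
Qed.

(** Homogeneity: a nonzero [x] is rescaled to the unit sphere of [nu]. This pointwise form is how
    the dual norm constraint is used below. *)
Lemma dual_normP b (lam : R) :
  (dual_norm nu b <= lam%:E)%E <-> forall x, inner b x <= lam * nu x.
Proof.
split=> [bl x|bl].
  have [->|x0] := eqVneq x 0; first by rewrite innerC inner0l nu0 mulr0.
  rewrite mulrC -ler_pdivrMl ?nu_gt0// -innerZr -lee_fin.
  apply: le_trans bl; apply: ereal_sup_ubound; exists ((nu x)^-1 *: x) => //=.
  rewrite (norm_homogeneous Hnu) ger0_norm ?invr_ge0 ?nu_ge0//.
  by rewrite mulVf// gt_eqF// nu_gt0.
apply: ge_ereal_sup => _ [x /= x1 <-]; rewrite lee_fin (le_trans (bl x))//.
by rewrite ler_piMr//; exact: nu_bound_ge0 bl.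
Qed.

End norm.

(** * The logistic loss: Lipschitz bound, continuity, measurability *)

Section loss.
Variables (R : realType) (n : nat).
Implicit Types (b x : 'rV[R]_n.+1) (u v y lam kappa : R).

Definition softplus u : R := ln (1 + expR u).

Lemma softplus_ge0 u : 0 <= softplus u.
Proof. by rewrite ln_ge0// lerDl expR_ge0. Qed.

Lemma softplus_ge u : u <= softplus u.
Proof.
rewrite -{1}(expRK u) ler_ln ?posrE ?expR_gt0 ?addr_gt0 ?expR_gt0//.
by rewrite lerDr.
Qed.

(** After exponentiation: 1 + e^u <= (1 + e^v) e^|u-v|, term by term. *)
Lemma softplus_lip u v : softplus u <= softplus v + `|u - v|.
Proof.
have pos t : 0 < 1 + expR t by rewrite addr_gt0 ?expR_gt0.
rewrite -(expRK `|u - v|) -lnM ?posrE ?expR_gt0//.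
rewrite ler_ln ?posrE ?mulr_gt0 ?expR_gt0// mulrDl mul1r -expRD lerD//.
  by rewrite -expR0 ler_expR.
by rewrite ler_expR -lerBlDl ler_norm.
Qed.

Lemma continuous_softplus : continuous softplus.
Proof.
move=> u; apply: (@continuous_comp _ _ _ (fun v => 1 + expR v) (@ln R)).
  by apply: cvgD; [exact: cvg_cst|exact: continuous_expR].
by apply: continuous_ln; rewrite addr_gt0 ?expR_gt0.
Qed.

Lemma logloss_ge0 b x y : 0 <= logloss b x y.
Proof. exact: softplus_ge0. Qed.

Lemma continuous_logloss_beta x y : continuous (fun b => logloss b x y).
Proof.
move=> b; apply: (@continuous_comp _ _ _ (fun b => - y * inner b x) softplus).
  apply: (@continuous_comp _ _ _ (fun b => inner b x) ( *%R (- y))).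
    exact: continuous_innerl.
  exact: mulrl_continuous.
exact: continuous_softplus.
Qed.

Lemma continuous_logloss_feature b y : continuous (fun x => logloss b x y).
Proof.
move=> x; apply: (@continuous_comp _ _ _ (fun x => - y * inner b x) softplus).
  apply: (@continuous_comp _ _ _ (inner b) ( *%R (- y))).
    exact: continuous_innerr.
  exact: mulrl_continuous.
exact: continuous_softplus.
Qed.

Lemma continuous_measurable_Rn (f : 'rV[R]_n.+1 -> R) :
  continuous f -> measurable_fun [set: Rn R n.+1] (f : Rn R n.+1 -> R).
Proof.
move=> /continuousP fc.
apply: (measurability _ (RGenOpens.measurableE R)).
move=> _ [_ [a [b' ->]] <-]; rewrite setTI; apply: sub_sigma_algebra.
by apply: fc; exact: interval_open.
Qed.

Definition robust_loss kappa lam b (w : Xi R n.+1) : R :=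
  Num.max (logloss b w.1 (label R w.2))
          (logloss b w.1 (- label R w.2) - lam * kappa).

Lemma robust_loss_ge0 kappa lam b w : 0 <= robust_loss kappa lam b w.
Proof. by rewrite le_max logloss_ge0. Qed.

(** Move the feature first, keeping the label, at a cost of [lam * nu (x - x')]. Equal labels then
    give the first branch of the maximum; a label change has distance [kappa], which cancels the
    [- lam * kappa] of the second branch. *)
Lemma logloss_transport (nu : 'rV[R]_n.+1 -> R) kappa lam b (w w' : Xi R n.+1) :
  (forall x, inner b x <= lam * nu x) -> (forall x, nu (- x) = nu x) ->
  logloss b w.1 (label R w.2) <=
    lam * dist nu kappa w w' + robust_loss kappa lam b w'.
Proof.
case: w w' => [x l] [x' l'] bnu nuN /=.
have feature y : `|y| = 1 -> logloss b x y <= logloss b x' y + lam * nu (x - x').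
  move=> y1; apply: le_trans (softplus_lip _ (- y * inner b x')) _.
  rewrite lerD2l -mulrBr -innerBr normrM normrN y1 mul1r ler_norml bnu andbT.
  by have := bnu (- (x - x')); rewrite nuN -scaleN1r innerZr; lra.
have l1 (c : bool) : `|label R c| = 1 by case: c; rewrite /= ?normrN1 ?normr1.
apply: le_trans (feature _ (l1 l)) _; rewrite /dist /robust_loss /=.
have [->|ll'] := eqVneq l l'.
  by rewrite subrr normr0 mulr0 mul0r addr0 addrC lerD2l le_max lexx.
have -> : label R l = - label R l'.
  by case: l l' {l1} ll' => -[]//= _; rewrite opprK.
rewrite -opprD normrN -mulr2n normrMn l1 -mulr_natr mul1r -mulrA divff// mulr1.
by rewrite mulrDr -addrA addrC lerD2r -lerBlDl le_max lexx orbT.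
Qed.

Lemma measurable_logloss_Xi b (s : bool -> R) :
  measurable_fun [set: Xi R n.+1] (fun w : Xi R n.+1 => logloss b w.1 (s w.2)).
Proof.
rewrite (_ : (fun _ => _) = (fun w : Xi R n.+1 =>
   if w.2 then logloss b w.1 (s true) else logloss b w.1 (s false))).
  apply: (measurable_fun_if_pair (X := Rn R n.+1)
    (x := fun x => logloss b x (s true)) (y := fun x => logloss b x (s false)));
    apply: continuous_measurable_Rn; exact: continuous_logloss_feature.
by apply/funext => -[x []].
Qed.

Lemma measurable_robust_loss kappa lam b :
  measurable_fun [set: Xi R n.+1] (robust_loss kappa lam b).
Proof.
apply: measurable_maxr; first exact: measurable_logloss_Xi.
apply: measurable_funB => //.
exact: (measurable_logloss_Xi b (fun c => - label R c)).
Qed.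

End loss.

(** * Finitely supported probabilities and integrals against them *)

Section finite_support.
Import HBNNSimple.
Local Open Scope ereal_scope.
Context d (T : measurableType d) (R : realType) (I : finType).
Variables (w : I -> {nonneg R}) (p : I -> T) (i0 : I).

Let dirac_sum : measure T R := msum
  (fun k => mscale (w (nth i0 (enum I) k)) (\d_(p (nth i0 (enum I) k)) : measure T R)) #|I|.

Let sum_enum (F : I -> \bar R) :
  \sum_(k < #|I|) F (nth i0 (enum I) k) = \sum_i F i.
Proof. by rewrite -[RHS]big_enum (big_nth i0) -cardE big_mkord. Qed.

Let dirac_sumE A : dirac_sum A = \sum_i (w i)%:num%:E * \d_(p i) A.
Proof. exact: (sum_enum (fun i => (w i)%:num%:E * \d_(p i) A)). Qed.

Lemma finite_support_probability : (\sum_i (w i)%:num = 1)%R ->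
  exists P : probability T R,
    forall A, P A = \sum_i (w i)%:num%:E * \d_(p i) A.
Proof.
move=> w1; have m1 : dirac_sum setT = 1.
  rewrite dirac_sumE (eq_bigr (fun i => (w i)%:num%:E)) ?sumEFin ?w1// => i _.
  by rewrite diracT mule1.
(* Normalising only supplies the probability structure: the mass is already 1, so the fallback Dirac
   measure is never reached. *)
exists (mnormalize dirac_sum (\d_(p i0) : probability T R)) => A.
by rewrite -dirac_sumE /= /mnormalize m1 eqe oner_eq0/= invr1 mule1.
Qed.

Lemma integral_finite_support (mu : measure T R) (f : T -> \bar R) :
    (forall A, measurable A -> mu A = \sum_i (w i)%:num%:E * \d_(p i) A) ->
    (forall x, 0 <= f x) -> measurable_fun setT f ->
  \int[mu]_x f x = \sum_i (w i)%:num%:E * f (p i).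
Proof.
move=> muE f0 mf; rewrite (eq_measure_integral dirac_sum); last first.
  by move=> A mA _; rewrite dirac_sumE muE.
rewrite ge0_integral_measure_sum// -(sum_enum (fun i => (w i)%:num%:E * f (p i))).
apply: eq_bigr => k _; rewrite ge0_integral_mscale//.
by rewrite integral_dirac// diracT mul1e.
Qed.

(* The integral of a nonnegative, possibly nonmeasurable, function is the
   supremum of the integrals of the simple functions below it. *)
Lemma integral_finite_support_le (mu : measure T R) (f : T -> \bar R) :
    (forall A, measurable A -> mu A = \sum_i (w i)%:num%:E * \d_(p i) A) ->
    (forall x, 0 <= f x) ->
  \int[mu]_x f x <= \sum_i (w i)%:num%:E * f (p i).
Proof.
move=> muE f0; rewrite ge0_integralTE//; apply: ge_ereal_sup => _ [h /= hf <-].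
rewrite -integralT_nnsfun integral_finite_support//.
- by apply: lee_sum => i _; exact: lee_wpmul2l.
- by move=> x; rewrite lee_fin fun_ge0.
- exact/measurable_EFinP.
Qed.

End finite_support.

(** * Monotonicity of the integral of nonnegative functions *)

Section nonmeasurable_bound.
Local Open Scope ereal_scope.
Context d (T : measurableType d) (R : realType) (mu : measure T R).

(** A simple function below [f] is also below [g], so the suprema compare. This allows bounds by the
    transport cost without proving it measurable. *)
Lemma ge0_le_integral_nonmeasurable (f g : T -> \bar R) :
    (forall x, 0 <= f x) -> (forall x, f x <= g x) ->
  \int[mu]_x f x <= \int[mu]_x g x.
Proof.
move=> f0 fg; rewrite !ge0_integralTE//; last first.
  by move=> x; exact: le_trans (f0 x) (fg x).
apply: ereal_sup_le => _ [h hf <-]; exists h => // x.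
exact: le_trans (hf x) (fg x).
Qed.

End nonmeasurable_bound.

(** * Marginals of a coupling as pushforwards under the projections *)

Section coupling.
Local Open Scope ereal_scope.
Context (R : realType) (n : nat).
Variables (Q P : probability (Xi R n) R) (Pi : probability (Xi R n * Xi R n)%type R).
Hypothesis QP : is_coupling Q P Pi.

Lemma integral_coupling1 (f : Xi R n -> \bar R) :
    (forall w, 0 <= f w) -> measurable_fun setT f ->
  \int[Q]_w f w = \int[Pi]_w f w.1.
Proof.
move=> f0 mf; rewrite (eq_measure_integral (pushforward Pi fst)); last first.
  move=> A mA _; apply: etrans (esym (QP.1 _ mA)) _; congr (Pi _).
  by apply/seteqP; split=> w => [[]|].
by rewrite ge0_integral_pushforward ?preimage_setT//.
Qed.

Lemma integral_coupling2 (f : Xi R n -> \bar R) :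
    (forall w, 0 <= f w) -> measurable_fun setT f ->
  \int[P]_w f w = \int[Pi]_w f w.2.
Proof.
move=> f0 mf; rewrite (eq_measure_integral (pushforward Pi snd)); last first.
  move=> A mA _; apply: etrans (esym (QP.2 _ mA)) _; congr (Pi _).
  by apply/seteqP; split=> w => [[]|].
by rewrite ge0_integral_pushforward ?preimage_setT//.
Qed.

End coupling.

(** * Weak duality: upper bound on the worst-case loss *)

Section weak_duality.
Context (R : realType) (n N : nat) (nu : 'rV[R]_n.+1 -> R) (Hnu : is_norm nu).
Context (z : 'I_N.+1 -> Xi R n.+1).

Lemma empiricalE A :
  empirical z A = (\sum_i (N.+1%:R^-1 : R)%:E * \d_(z i) A)%E.
Proof. by rewrite /empirical ge0_sume_distrr. Qed.

Lemma integral_empirical (f : Xi R n.+1 -> R) :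
    (forall w, 0 <= f w) -> measurable_fun setT f ->
  (\int[empirical z]_w (f w)%:E = (N.+1%:R^-1 * \sum_i f (z i))%:E)%E.
Proof.
move=> f0 mf; rewrite (integral_finite_support (w := fun=> (N.+1%:R^-1)%:nng)
  (p := z) ord0) => [||w|].
- by rewrite /= mulr_sumr -sumEFin; apply: eq_bigr => i _; rewrite EFinM.
- by move=> A _; rewrite -empiricalE.
- by rewrite lee_fin.
- exact/measurable_EFinP.
Qed.

Lemma worst_case_loss_le (kappa eps lam : R) b :
    0 <= kappa -> (forall x, inner b x <= lam * nu x) ->
  (worst_case_loss nu kappa eps (empirical z) b <=
   (lam * eps + N.+1%:R^-1 * \sum_i robust_loss kappa lam b (z i))%:E)%E.
Proof.
move=> kappa0 bnu; apply: ge_ereal_sup => _ [Q QB <-].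
have nuN := nuN Hnu; have nu_ge0 := nu_ge0 Hnu.
have lam0 : 0 <= lam := nu_bound_ge0 Hnu bnu.
pose l (w : Xi R n.+1) : R := logloss b w.1 (label R w.2).
pose g := robust_loss kappa lam b.
have l0 w : 0 <= l w by exact: logloss_ge0.
have g0 w : 0 <= g w by exact: robust_loss_ge0.
have ml : measurable_fun setT l := measurable_logloss_Xi b (label R).
have mg : measurable_fun setT g := measurable_robust_loss kappa lam b.
have d0 w w' : 0 <= dist nu kappa w w'.
  by rewrite addr_ge0// divr_ge0// mulr_ge0.
(* A measurable stand-in for [lam * dist]: it lies below that cost, and [l w.1 <= h w + g w.2], so
   the integral can be split additively. *)
pose h (w : Xi R n.+1 * Xi R n.+1) : R := Num.max (l w.1 - g w.2) 0.
have h0 w : 0 <= h w by rewrite le_max lexx orbT.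
have mh : measurable_fun setT h.
  apply: measurable_maxr => //; apply: measurable_funB.
    exact: measurableT_comp ml measurable_fst.
  exact: measurableT_comp mg measurable_snd.
have hd w : h w <= lam * dist nu kappa w.1 w.2.
  rewrite ge_max mulr_ge0// andbT lerBlDr; exact: logloss_transport.
apply/lee_addgt0Pr => e e0.
suff [Pi QPi hPi] : exists2 Pi, is_coupling Q (empirical z) Pi &
    (\int[Pi]_w (h w)%:E <= (lam * eps + e)%:E)%E.
  have l0' w : (0 <= (l w)%:E)%E by rewrite lee_fin.
  have ml' : measurable_fun setT (EFin \o l) by exact/measurable_EFinP.
  rewrite expectation.unlock (integral_coupling1 QPi l0' ml').
  apply: (@le_trans _ _ (\int[Pi]_w ((h w)%:E + (g w.2)%:E))%E).
    apply: ge0_le_integral_nonmeasurable => w; first by rewrite lee_fin.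
    by rewrite -EFinD lee_fin -lerBlDr le_max lexx.
  rewrite ge0_integralD//=; last 4 first.
  - by move=> w _; rewrite lee_fin.
  - exact/measurable_EFinP.
  - by move=> w _; rewrite lee_fin.
  - by apply/measurable_EFinP; exact: measurableT_comp mg measurable_snd.
  have g0' w : (0 <= (g w)%:E)%E by rewrite lee_fin.
  have mg' : measurable_fun setT (EFin \o g) by exact/measurable_EFinP.
  rewrite -(integral_coupling2 QPi g0' mg').
  rewrite integral_empirical//; apply: le_trans (leeD hPi (lexx _)) _.
  by rewrite -!EFinD lee_fin addrAC.
(* The infimum over couplings need not be known to be attained; the excess [e / (lam + 1)] stays
   below [e] after multiplication by [lam], and makes sense for [lam = 0]. *)
have [Pi QPi Pid] : exists2 Pi, is_coupling Q (empirical z) Pi &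
    (\int[Pi]_w (dist nu kappa w.1 w.2)%:E <= (eps + e / (lam + 1))%:E)%E.
  have : (wasserstein nu kappa Q (empirical z) < (eps + e / (lam + 1))%:E)%E.
    apply: le_lt_trans QB _; rewrite lte_fin ltrDl divr_gt0//.
    exact: ltr_wpDl.
  by move=> /ereal_inf_lt[_ [Pi QPi <-] /ltW ?]; exists Pi.
exists Pi => //; have [lam_eq0|lam_neq0] := eqVneq lam 0.
  rewrite (eq_integral (cst 0%E)) => [|w _].
    by rewrite integral0 lam_eq0 mul0r add0r lee_fin ltW.
  congr EFin; apply/eqP; rewrite eq_le h0 andbT.
  by have := hd w; rewrite lam_eq0 mul0r.
have lam_gt0 : 0 < lam by rewrite lt_neqAle eq_sym lam_neq0.
(* The factor [lam] is extracted from the measurable [h] rather than from the transport cost. *)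
have -> : (\int[Pi]_w (h w)%:E = lam%:E * \int[Pi]_w (lam^-1 * h w)%:E)%E.
  rewrite -ge0_integralZl//=; first last.
  - by move=> w _; rewrite lee_fin mulr_ge0// invr_ge0.
  - by apply/measurable_EFinP; exact: measurable_funM.
  by apply: eq_integral => w _; rewrite -EFinM mulrA divff// mul1r.
apply: (@le_trans _ _ (lam%:E * (eps + e / (lam + 1))%:E)%E).
  apply: lee_wpmul2l; first by rewrite lee_fin.
  apply: le_trans Pid; apply: ge0_le_integral_nonmeasurable => w.
    by rewrite lee_fin mulr_ge0// invr_ge0.
  by rewrite lee_fin ler_pdivrMl.
rewrite -EFinM lee_fin mulrDr lerD2l mulrCA ler_piMr//; first exact: ltW.
by rewrite ler_pdivrMr ?mul1r ?lerDl// ltr_wpDl.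
Qed.

End weak_duality.

(** * Lower bounds from explicit distributions in the ball *)

Section lower_bound.
Context (R : realType) (n N : nat) (nu : 'rV[R]_n.+1 -> R) (Hnu : is_norm nu).
Context (z : 'I_N.+1 -> Xi R n.+1) (kappa eps : R) (kappa0 : 0 <= kappa).
Implicit Types (b v : 'rV[R]_n.+1).

Let dist_ge0 (w w' : Xi R n.+1) : 0 <= dist nu kappa w w'.
Proof. by rewrite addr_ge0 ?nu_ge0// divr_ge0// mulr_ge0. Qed.

(** The atom [z i] is split into pieces indexed by [J], piece [(i, j)] being moved to [q (i, j)].
    Putting mass [w k] on the pair [(q k, z k.1)] is a coupling whose cost is the given sum. *)
Lemma worst_case_loss_ge_finite (J : finType) (j0 : J)
    (w : 'I_N.+1 * J -> {nonneg R}) (q : 'I_N.+1 * J -> Xi R n.+1) b :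
    (forall i, \sum_j (w (i, j))%:num = N.+1%:R^-1) ->
    \sum_k (w k)%:num * dist nu kappa (q k) (z k.1) <= eps ->
  ((\sum_k (w k)%:num * logloss b (q k).1 (label R (q k).2))%:E <=
   worst_case_loss nu kappa eps (empirical z) b)%E.
Proof.
move=> wN wd.
have w1 : \sum_k (w k)%:num = 1.
  rewrite (eq_bigr (fun k => (w (k.1, k.2))%:num)); last by case.
  rewrite -(pair_bigA _ (fun i j => (w (i, j))%:num))/=.
  under eq_bigr do rewrite wN.
  by rewrite sumr_const card_ord -[LHS]mulr_natr mulVf.
have k0 : 'I_N.+1 * J := (ord0, j0).
have [Q QE] := finite_support_probability q k0 w1.
have [Pi PiE] := finite_support_probability (fun k => (q k, z k.1)) k0 w1.
have QPi : is_coupling Q (empirical z) Pi.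
  split=> A mA; rewrite PiE ?QE.
    apply: eq_bigr => k _; congr (_ * _)%E; rewrite !diracE; congr ((nat_of_bool _)%:R%:E).
    by apply/idP/idP; rewrite !inE /= => // -[].
  apply: etrans (esym (empiricalE z A)); rewrite (eq_bigr
      (fun k => (w (k.1, k.2))%:num%:E * \d_(z k.1) A)%E) => [|[i j] _]; last first.
    congr (_ * _)%E; rewrite !diracE; congr ((nat_of_bool _)%:R%:E).
    by apply/idP/idP; rewrite !inE /= => // -[].
  rewrite -(pair_bigA _ (fun i j => (w (i, j))%:num%:E * \d_(z i) A)%E)/=.
  apply: eq_bigr => i _; rewrite -ge0_sume_distrl//.
  by rewrite sumEFin wN.
apply: ereal_sup_ubound; exists Q.
  apply: ge_ereal_inf; exists (\int[Pi]_w (dist nu kappa w.1 w.2)%:E)%E.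
    by exists Pi.
  apply: le_trans (integral_finite_support_le k0 (fun A _ => PiE A) _) _.
    by move=> ?; rewrite lee_fin.
  by rewrite -lee_fin -sumEFin in wd.
have l0 (u : Xi R n.+1) : (0 <= (logloss b u.1 (label R u.2))%:E)%E.
  by rewrite lee_fin logloss_ge0.
rewrite expectation.unlock (integral_finite_support k0 (fun A _ => QE A) l0).
  by rewrite -sumEFin; apply: eq_bigr => k _; rewrite EFinM.
apply/measurable_EFinP; exact: measurable_logloss_Xi.
Qed.

Lemma logloss_ge_linear b (x : 'rV[R]_n.+1) (y : R) : - y * inner b x <= logloss b x y.
Proof. exact: softplus_ge. Qed.

Lemma dist_same_label (x x' : 'rV[R]_n.+1) (l : bool) :
  dist nu kappa (x, l) (x', l) = nu (x - x').
Proof. by rewrite /dist /= subrr normr0 mulr0 mul0r addr0. Qed.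

Lemma dist_flip (x : 'rV[R]_n.+1) (l : bool) :
  dist nu kappa (x, ~~ l) (x, l) = kappa.
Proof.
rewrite /dist /= subrr nu0// add0r.
have -> : `|label R (~~ l) - label R l| = 2.
  by case: l; rewrite /= ?opprK -?opprD ?normrN ger0_norm.
by rewrite mulfK.
Qed.

Lemma label_negb (l : bool) : label R (~~ l) = - label R l.
Proof. by case: l; rewrite /= ?opprK. Qed.

Let a b i := logloss b (z i).1 (label R (z i).2).
Let c b i := logloss b (z i).1 (- label R (z i).2).
Let avg (f : 'I_N.+1 -> R) := N.+1%:R^-1 * \sum_i f i.

(* A fraction alpha of each data point is sent to distance of order 1 / alpha,
   where the loss is asymptotically linear; the rest keeps its feature and
   flips its label with probability theta. *)
Lemma worst_case_loss_ge b v (theta : 'I_N.+1 -> R) :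
    (forall i, 0 <= theta i <= 1) -> kappa * avg theta <= eps -> nu v <= 1 ->
  ((avg (fun i => (1 - theta i) * a b i + theta i * c b i)
     + (eps - kappa * avg theta) * inner b v)%:E <=
   worst_case_loss nu kappa eps (empirical z) b)%E.
Proof.
move=> theta01 theta_eps v1.
pose u i := (1 - theta i) * a b i + theta i * c b i.
pose q i := - label R (z i).2 * inner b (z i).1.
(* Diverting a fraction alpha of the mass replaces [u] by the linear part [q] there and loses at
   most alpha times [M]; alpha is chosen to keep this loss below [e]. *)
pose M := `|avg (fun i => q i - u i)|.
have M0 : 0 <= M by exact: normr_ge0.
pose rho := eps - kappa * avg theta.
have rho0 : 0 <= rho by rewrite subr_ge0.
apply/lee_addgt0Pr => e e0.
have [alpha [alpha0 alpha1 alphaM]] :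
    exists alpha, [/\ 0 < alpha, alpha <= 1 & alpha * M <= e].
  have Me0 : 0 < M + e by rewrite ltr_wpDl.
  exists (e / (M + e)); split; first exact: divr_gt0.
    by rewrite ler_pdivrMr// mul1r lerDr.
  by rewrite mulrAC ler_pdivrMr// ler_wpM2l ?lerDl// ltW.
have alpha_ge0 : 0 <= alpha by exact: ltW.
pose wt (i : 'I_N.+1) (k : option bool) : R := match k with
  | None => alpha | Some true => (1 - alpha) * theta i
  | Some false => (1 - alpha) * (1 - theta i) end.
have wt0 i k : 0 <= N.+1%:R^-1 * wt i k.
  rewrite mulr_ge0//; have /andP[? ?] := theta01 i.
  by rewrite /wt; case: k => [[]|]//; rewrite mulr_ge0 ?subr_ge0.
(* [None] is the far piece, [Some true] the flipped one, [Some false] the unmoved one. Mass alpha at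
   distance [rho / alpha * nu v] costs [rho * nu v]; the sign of the shift raises the exponent of
   the loss by [rho / alpha * inner b v]. *)
pose pt (i : 'I_N.+1) (k : option bool) : Xi R n.+1 := match k with
  | None => ((z i).1 - (label R (z i).2 * (rho / alpha)) *: v : 'rV[R]_n.+1, (z i).2)
  | Some true => ((z i).1, ~~ (z i).2) | Some false => z i end.
have sum3 (F : option bool -> R) : \sum_k F k = F None + (F (Some true) + F (Some false)).
  rewrite (bigD1 None)// (bigD1 (Some true))// (bigD1 (Some false))//=.
  by rewrite big1 ?addr0// => -[[]|].
pose w (k : 'I_N.+1 * option bool) := NngNum (wt0 k.1 k.2).
have sum_w (F : 'I_N.+1 * option bool -> R) :
    \sum_k (w k)%:num * F k = avg (fun i => \sum_k wt i k * F (i, k)).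
  rewrite (eq_bigr (fun k => N.+1%:R^-1 * (wt k.1 k.2 * F (k.1, k.2)))).
    rewrite -(pair_bigA _ (fun i k => N.+1%:R^-1 * (wt i k * F (i, k))))/=.
    by rewrite /avg mulr_sumr; apply: eq_bigr => i _; rewrite mulr_sumr.
  by case=> i k _ /=; rewrite mulrA.
have wN i : \sum_k (w (i, k))%:num = N.+1%:R^-1.
  by rewrite sum3 /=; ring.
have wd : \sum_k (w k)%:num * dist nu kappa (pt k.1 k.2) (z k.1) <= eps.
  rewrite sum_w (_ : avg _ = (1 - alpha) * (kappa * avg theta) + rho * nu v).
    have : alpha * (kappa * avg theta) >= 0.
      rewrite mulr_ge0 ?mulr_ge0 ?sumr_ge0// => i _.
      by case/andP: (theta01 i).
    have : rho * nu v <= rho by rewrite ler_piMr.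
    by rewrite {2}/rho; lra.
  rewrite {1}/avg (eq_bigr (fun i => (1 - alpha) * kappa * theta i + rho * nu v)).
    rewrite big_split/= -mulr_sumr sumr_const card_ord mulrDr /avg; congr (_ + _).
      ring.
    by rewrite -(mulr_natl (rho * _)) mulKf.
  move=> i _; rewrite sum3 /wt /pt /=; case: (z i) => x l /=.
  rewrite dist_flip !dist_same_label subrr nu0// addrAC subrr add0r nuN//.
  rewrite (norm_homogeneous Hnu) normrM (_ : `|label R l| = 1); last first.
    by case: l; rewrite /= ?normrN1 ?normr1.
  rewrite ger0_norm ?divr_ge0//.
  by field; rewrite gt_eqF.
apply: (le_trans _ (leeD (worst_case_loss_ge_finite None (q := fun k => pt k.1 k.2)
  b wN wd) (lexx _))).
rewrite -EFinD lee_fin sum_w -/rho.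
(* The linear minorant of the loss is used on the far piece only; multiplying by alpha leaves the
   gain [rho * inner b v] independent of alpha. *)
have lin i : (1 - alpha) * u i + alpha * q i + rho * inner b v <=
    \sum_k wt i k * logloss b (pt i k).1 (label R (pt i k).2).
  rewrite sum3 /= label_negb -/(a b i) -/(c b i).
  have := logloss_ge_linear b
    ((z i).1 - (label R (z i).2 * (rho / alpha)) *: v) (label R (z i).2).
  move=> /(ler_wpM2l alpha_ge0).
  have -> : alpha * (- label R (z i).2 * inner b
      ((z i).1 - (label R (z i).2 * (rho / alpha)) *: v)) =
      alpha * q i + rho * inner b v.
    have ll : label R (z i).2 * label R (z i).2 = 1.
      by case: (z i).2; rewrite /= ?mulrNN mulr1.
    rewrite innerBr innerZr mulrBr /q -[in RHS](mul1r rho) -ll.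
    by field; rewrite gt_eqF.
  by rewrite /u; lra.
have avg_lin : (1 - alpha) * avg u + alpha * avg q + rho * inner b v <=
    avg (fun i => \sum_k wt i k * logloss b (pt i k).1 (label R (pt i k).2)).
  apply: (@le_trans _ _ (avg (fun i => (1 - alpha) * u i + alpha * q i + rho * inner b v))).
    rewrite {3}/avg 2!big_split/= -!mulr_sumr sumr_const card_ord !mulrDr /avg.
    rewrite -(mulr_natl (inner b v)) (mulrCA rho) mulKf//.
    by rewrite (mulrCA (1 - alpha)) (mulrCA alpha).
  by rewrite ler_wpM2l//; apply: ler_sum => i _; exact: lin.
have avgB : avg (fun i => q i - u i) = avg q - avg u.
  by rewrite /avg sumrB mulrBr.
have : - M <= avg q - avg u by rewrite /M avgB lerNl -normrN ler_norm.
move=> /(ler_wpM2l alpha_ge0); rewrite -/avg -/u.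
lra.
Qed.

End lower_bound.

(** * The fractional knapsack problem *)

Section knapsack.
Context (R : realType) (I : finType) (r : I -> R) (D m : R).
Hypothesis m0 : 0 <= m.

(** The finitely many candidates for the optimal [lam]: the breakpoints [r i] clipped at [D], and
    [D] itself at [None]. *)
Let rr (o : option I) : R := if o is Some i then Num.max D (r i) else D.
Let cnt (t : R) : R := \sum_i (t < r i)%R%:R.

Let rr_ge o : D <= rr o.
Proof. by case: o => [i|]; rewrite /rr ?le_max lexx. Qed.

(* Complementary slackness for the fractional knapsack problem dual to
   minimising lam * m + \sum_i max 0 (r i - lam) over lam >= D; the optimal
   lam is D or one of the r i. *)
Lemma fractional_knapsack : exists lam (theta : I -> R),
  [/\ D <= lam, forall i, 0 <= theta i <= 1, \sum_i theta i <= m,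
      (lam - D) * (m - \sum_i theta i) = 0
    & forall i, theta i * (r i - lam) = Num.max 0 (r i - lam)].
Proof.
(* No [r i] exceeds the largest candidate, so its count is 0 and candidates with count at most [m]
   exist; [lam] is the least of them. *)
pose top := [arg max_(o > None) rr o]%O.
have Ptop : cnt (rr top) <= m.
  rewrite /cnt big1// => i _; rewrite /top; case: arg_maxP => // o _ omax.
  by have /= := omax (Some i) isT; rewrite {1}/rr /= ge_max => /andP[_]; rewrite leNgt => /negbTE->.
case: (arg_minP rr (Ptop : (fun o => cnt (rr o) <= m) top)) => o Po omin.
pose lam := rr o; rewrite -/lam in Po omin.
have [lamD|lamD] := eqVneq lam D.
  exists lam, (fun i => (lam < r i)%R%:R); split => //; first exact: rr_ge.
  - by move=> i; case: ltP; rewrite ?lexx ?ler01.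
  - by rewrite lamD subrr mul0r.
  move=> i; case: ltP => h; first by rewrite mul1r max_r// subr_ge0 ltW.
  by rewrite mul0r max_l// subr_le0.
have Dlam : D < lam by rewrite lt_neqAle eq_sym lamD rr_ge.
(* The candidate just below [lam]: by minimality its count exceeds [m], and no breakpoint lies
   strictly between the two. *)
have [j rj jmax] := arg_maxP rr (Dlam : (fun o => rr o < lam) None).
have mj : m < cnt (rr j).
  by rewrite ltNge; apply/negP => /omin; rewrite leNgt rj.
have above i : (rr j < r i) = (lam <= r i).
  apply/idP/idP => [ji|li]; last exact: lt_le_trans li.
  rewrite leNgt; apply/negP => il.
  have : rr (Some i) < lam by rewrite /rr gt_max Dlam.
  by move=> /jmax; rewrite {1}/rr /= ge_max => /andP[_]; rewrite leNgt ji.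
(* Strict and weak counts satisfy [A <= m < B]; giving every index tied at [lam] the fraction [s]
   spends the budget [m] exactly. *)
pose A := cnt lam; pose B := \sum_i (lam <= r i)%R%:R : R.
have AB : B - A = \sum_i (lam == r i)%:R.
  rewrite -sumrB; apply: eq_bigr => i _.
  by rewrite le_eqVlt; case: eqVneq => [->|_]; rewrite ?ltxx ?subr0 ?subrr.
have mB : m < B by rewrite (lt_le_trans mj)// /cnt; under eq_bigr do rewrite above.
have BA0 : 0 < B - A by rewrite subr_gt0 (le_lt_trans Po).
pose s := (m - A) / (B - A).
have s0 : 0 <= s by apply: divr_ge0; [rewrite subr_ge0|exact: ltW].
have s1 : s <= 1 by rewrite ler_pdivrMr// mul1r lerD2r ltW.
have sum_theta : \sum_i ((lam < r i)%R%:R + s * (lam == r i)%:R) = m.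
  rewrite big_split/= -mulr_sumr -AB -/(cnt lam) -/A /s divfK ?gt_eqF//.
  by rewrite addrC subrK.
exists lam, (fun i => (lam < r i)%R%:R + s * (lam == r i)%:R).
split; rewrite ?sum_theta ?subrr ?mulr0// ?ltW// => i.
  by case: ltgtP; rewrite ?mulr0 ?mulr1 ?addr0 ?add0r ?lexx ?ler01 ?s0 ?s1.
case: ltgtP => [il|il|->]; rewrite ?mulr0 ?mulr1 ?addr0 ?add0r ?mul1r ?mul0r.
- by rewrite max_r// subr_ge0 ltW.
- by rewrite max_l// subr_le0 ltW.
- by rewrite subrr mulr0 maxxx.
Qed.

End knapsack.

(** * Strong duality for a fixed beta *)

Section strong_duality.
Context (R : realType) (n N : nat) (nu : 'rV[R]_n.+1 -> R) (Hnu : is_norm nu).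
Context (z : 'I_N.+1 -> Xi R n.+1) (kappa eps : R).
Hypotheses (kappa0 : 0 < kappa) (eps0 : 0 <= eps).

(** One feasible [lam] for each [b] suffices, since the final program minimises jointly over
    both. *)
Lemma worst_case_loss_dual b : exists2 lam,
  (dual_norm nu b <= lam%:E)%E &
  ((lam * eps + N.+1%:R^-1 * \sum_i robust_loss kappa lam b (z i))%:E <=
   worst_case_loss nu kappa eps (empirical z) b)%E.
Proof.
pose a i := logloss b (z i).1 (label R (z i).2).
pose c i := logloss b (z i).1 (- label R (z i).2).
pose D := fine (dual_norm nu b).
have DE : dual_norm nu b = D%:E by rewrite fineK// dual_norm_fin.
(* The budget counted in flips: flipping one data point entirely costs [kappa / N.+1]. *)
have m0 : 0 <= N.+1%:R * eps / kappa by rewrite divr_ge0 ?mulr_ge0// ltW.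
have [lam [theta [Dlam theta01 thetam slack rt]]] :=
  fractional_knapsack (fun i => (c i - a i) / kappa) D m0.
exists lam; first by rewrite DE lee_fin.
pose avg (f : 'I_N.+1 -> R) := N.+1%:R^-1 * \sum_i f i.
(* The radius left after flipping is a multiple of the knapsack slack, so complementary slackness
   passes to [rho]. *)
pose rho := eps - kappa * avg theta.
have rhoE : rho = kappa * N.+1%:R^-1 * (N.+1%:R * eps / kappa - \sum_i theta i).
  by rewrite /rho /avg; field; rewrite nat1r pnatr_eq0 gt_eqF.
have rho0 : 0 <= rho by rewrite rhoE mulr_ge0 ?mulr_ge0 ?subr_ge0// ltW.
have slack' : (lam - D) * rho = 0 by rewrite rhoE mulrCA slack mulr0.
have theta_eps : kappa * avg theta <= eps by rewrite -subr_ge0.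
pose V := avg (fun i => (1 - theta i) * a i + theta i * c i).
have rob i : robust_loss kappa lam b (z i) =
    (1 - theta i) * a i + theta i * c i - lam * kappa * theta i.
  have := rt i; rewrite /robust_loss -/(a i) -/(c i).
  have -> : Num.max (a i) (c i - lam * kappa) =
      a i + kappa * Num.max 0 ((c i - a i) / kappa - lam).
    rewrite maxr_pMr ?ltW// mulr0 addr_maxr addr0; congr Num.max.
    by field; rewrite gt_eqF.
  by move=> <-; field; rewrite gt_eqF.
have -> : lam * eps + N.+1%:R^-1 * \sum_i robust_loss kappa lam b (z i) =
    V + rho * D.
  under eq_bigr do rewrite rob.
  rewrite sumrB -mulr_sumr mulrBr.
  have -> : V + rho * D = V + lam * rho - (lam - D) * rho by ring.
  by rewrite slack' subr0 /V /rho /avg; ring.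
have key v : nu v <= 1 -> ((V + rho * inner b v)%:E <=
    worst_case_loss nu kappa eps (empirical z) b)%E.
  by move=> v1; exact: (worst_case_loss_ge Hnu z (ltW kappa0) b theta01 theta_eps v1).
have [rho_eq0|rho_neq0] := eqVneq rho 0.
  by have := key 0; rewrite nu0// ler01 rho_eq0 !mul0r; apply.
have rho_gt0 : 0 < rho by rewrite lt_neqAle eq_sym rho_neq0.
(* For a finite worst case [W], dividing [key] by [rho] bounds every [inner b v] by [(W - V) / rho],
   hence also the supremum [D]. *)
case: (worst_case_loss _ _ _ _ _) key => [W| |] key.
- rewrite lee_fin -lerBrDl mulrC -ler_pdivlMr// -lee_fin -DE.
  apply: ge_ereal_sup => _ [v /= v1 <-]; have := key v v1.
  by rewrite !lee_fin ler_pdivlMr// mulrC lerBrDl.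
- exact: leey.
- by have := key 0; rewrite nu0// ler01 => /(_ isT).
Qed.

End strong_duality.

(** * Attainment of the minimum for a positive radius *)

Section attainment.
Context (R : realType) (n N : nat) (nu : 'rV[R]_n.+1 -> R) (Hnu : is_norm nu).
Context (z : 'I_N.+1 -> Xi R n.+1) (kappa eps : R).

(* The objective with the slack variables s eliminated. *)
Definition reduced_objective (p : 'rV[R]_n.+1 * R) : R :=
  p.2 * eps + N.+1%:R^-1 * \sum_i robust_loss kappa p.2 p.1 (z i).

Lemma reduced_feasible b lam : (dual_norm nu b <= lam%:E)%E ->
  feasible nu kappa z (b, lam, fun i => robust_loss kappa lam b (z i)).
Proof.
by move=> blam; split=> // i; rewrite /robust_loss le_max lexx ?orbT.
Qed.

Lemma reduced_objective_le b lam s : feasible nu kappa z (b, lam, s) ->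
  reduced_objective (b, lam) <= objective eps (b, lam, s).
Proof.
move=> [sl sc _]; rewrite lerD2l ler_wpM2l//; apply: ler_sum => i _.
by rewrite /robust_loss ge_max sl sc.
Qed.

Lemma continuous_reduced_objective : continuous reduced_objective.
Proof.
have cst_snd (k : R) : continuous (fun p : 'rV[R]_n.+1 * R => p.2 * k).
  move=> p; apply: (@continuous_comp _ _ _ (fun p : 'rV[R]_n.+1 * R => p.2) (fun t : R => t * k)).
    exact: cvg_snd.
  exact: mulrr_continuous.
have closs (x : 'rV[R]_n.+1) y :
    continuous (fun p : 'rV[R]_n.+1 * R => logloss p.1 x y).
  move=> p; apply: (@continuous_comp _ _ _ (fun p : 'rV[R]_n.+1 * R => p.1) (fun b => logloss b x y)).
    exact: cvg_fst.
  exact: continuous_logloss_beta.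
have crob i : continuous (fun p : 'rV[R]_n.+1 * R => robust_loss kappa p.2 p.1 (z i)).
  move=> p; pose f (p : 'rV[R]_n.+1 * R) := logloss p.1 (z i).1 (label R (z i).2).
  pose g (p : 'rV[R]_n.+1 * R) :=
    logloss p.1 (z i).1 (- label R (z i).2) - p.2 * kappa.
  have cg : {for p, continuous g}.
    by apply: (@continuousB _ R); [exact: closs|exact: cst_snd].
  exact: (@continuous_max R _ f g p (closs _ _ _) cg).
have csum : continuous (fun p : 'rV[R]_n.+1 * R =>
    \sum_i robust_loss kappa p.2 p.1 (z i)).
  apply: continuous_big => [|i _].
    exact: add_continuous.
  exact: crob.
move=> p.
pose f (q : 'rV[R]_n.+1 * R) := q.2 * eps.
pose g (q : 'rV[R]_n.+1 * R) :=
  N.+1%:R^-1 * \sum_i robust_loss kappa q.2 q.1 (z i).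
have cg : {for p, continuous g}.
  apply: (@continuous_comp _ _ _
    (fun p => \sum_i robust_loss kappa p.2 p.1 (z i)) (fun t : R => N.+1%:R^-1 * t)).
    exact: csum.
  exact: mulrl_continuous.
exact: (@continuousD _ R _ f g p (cst_snd _ _) cg).
Qed.

(** By [dual_normP] the epigraph is an intersection of closed half-spaces, one for each [x]. *)
Lemma closed_dual_norm_epigraph :
  closed [set p : 'rV[R]_n.+1 * R | (dual_norm nu p.1 <= p.2%:E)%E].
Proof.
rewrite (_ : [set p | _] = \bigcap_(x in setT)
    ((fun p : 'rV[R]_n.+1 * R => p.2 * nu x - inner p.1 x) @^-1` [set t | 0 <= t])).
  apply: closed_bigI => x _; apply: preimage_closed; last exact: closed_ge.
  move=> p _.
  pose f (q : 'rV[R]_n.+1 * R) := q.2 * nu x.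
  pose g (q : 'rV[R]_n.+1 * R) := inner q.1 x.
  have cf : {for p, continuous f}.
    apply: (@continuous_comp _ _ _ (fun q : 'rV[R]_n.+1 * R => q.2)
      (fun t : R => t * nu x)); [exact: cvg_snd|exact: mulrr_continuous].
  have cg : {for p, continuous g}.
    apply: (@continuous_comp _ _ _ (fun q : 'rV[R]_n.+1 * R => q.1)
      (fun b => inner b x)); [exact: cvg_fst|exact: continuous_innerl].
  exact: (@continuousB _ R _ f g p cf cg).
apply/seteqP; split=> p /=.
  by move=> /(dual_normP Hnu) h x _ /=; rewrite subr_ge0.
by move=> h; apply/(dual_normP Hnu) => x; have := h x I; rewrite /= subr_ge0.
Qed.

Lemma compact_dual_norm_epigraph M :
  compact [set p : 'rV[R]_n.+1 * R | (dual_norm nu p.1 <= p.2%:E)%E /\ p.2 <= M].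
Proof.
(* Testing the constraint on opposite basis vectors bounds each coordinate of [b] by
   [lam * nu (delta_mx 0 j)], hence by [C]. *)
pose C := M * \sum_j nu (delta_mx 0 j).
have cC : compact ([set b : 'rV[R]_n.+1 | `|b| <= C] `*` `[0, M]).
  apply: compact_setX; last exact: segment_compact.
  apply: bounded_closed_compact.
    by exists C; split => [|c Cc b /= /le_trans]; [exact: num_real|apply; exact: ltW].
  apply: (preimage_closed (f := fun b : 'rV[R]_n.+1 => `|b|) (D := [set t | t <= C])).
    by move=> b _; exact: norm_continuous.
  exact: closed_le.
apply: subclosed_compact cC _.
  rewrite (_ : [set p | _] = [set p : 'rV[R]_n.+1 * R | (dual_norm nu p.1 <= p.2%:E)%E]
     `&` ((fun p : 'rV[R]_n.+1 * R => p.2) @^-1` [set t | t <= M])); last by apply/seteqP; split.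
  apply: closedI; first exact: closed_dual_norm_epigraph.
  apply: preimage_closed; last exact: closed_le.
  by move=> p _; exact: cvg_snd.
move=> [b lam] [/= /(dual_normP Hnu) blam lamM].
have bj j : `|b 0 j| <= lam * nu (delta_mx 0 j).
  have := blam (delta_mx 0 j); have := blam (- delta_mx 0 j).
  rewrite (nuN Hnu) -scaleN1r innerZr inner_delta ler_norml; lra.
have e0 j : 0 < nu (delta_mx 0 j) := nu_delta_gt0 Hnu j.
have lam0 : 0 <= lam := nu_bound_ge0 Hnu blam.
have M0 : 0 <= M := le_trans lam0 lamM.
split => /=; last by rewrite in_itv/= lam0.
have C0 : 0 <= C by rewrite mulr_ge0// sumr_ge0// => j _; rewrite ltW.
rewrite /Num.norm/= mx_normrE; apply/bigmax_leP; split=> // -[i j] _ /=.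
rewrite (ord1 i) (le_trans (bj j))// ler_pM// ?(ltW (e0 _))//.
by rewrite (bigD1 j)//= lerDl sumr_ge0// => k _; rewrite ltW.
Qed.

Lemma reduced_objective_min : 0 < eps ->
  exists2 p, (dual_norm nu p.1 <= p.2%:E)%E &
    forall q, (dual_norm nu q.1 <= q.2%:E)%E ->
      reduced_objective p <= reduced_objective q.
Proof.
move=> eps0.
pose p0 : 'rV[R]_n.+1 * R := (0, 0).
(* Losses are nonnegative, so a pair with [lam] at least [M] has objective at least [M * eps], the
   value at [p0]; only [lam <= M] matters. *)
pose M := reduced_objective p0 / eps.
have avg_ge0 p : 0 <= N.+1%:R^-1 * \sum_i robust_loss kappa p.2 p.1 (z i).
  by rewrite mulr_ge0// sumr_ge0// => i _; exact: robust_loss_ge0.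
have p0_ge0 : 0 <= reduced_objective p0.
  by rewrite /reduced_objective mul0r add0r.
have p0K : [set p : 'rV[R]_n.+1 * R |
    (dual_norm nu p.1 <= p.2%:E)%E /\ p.2 <= M] p0.
  split; last by rewrite divr_ge0// ltW.
  by apply/(dual_normP Hnu) => x; rewrite inner0l mul0r.
have [p] := compact_EVT_min (ex_intro _ p0 p0K) (compact_dual_norm_epigraph (M := M))
  (continuous_subspaceT continuous_reduced_objective).
rewrite inE => -[bp pM] pmin; exists p => // q bq.
have [qM|/ltW Mq] := leP q.2 M; first by apply: pmin; rewrite inE.
apply: (@le_trans _ _ (reduced_objective p0)); first by apply: pmin; rewrite inE.
move: Mq; rewrite ler_pdivrMr// => /le_trans; apply.
by rewrite /reduced_objective lerDl.
Qed.

End attainment.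

(** The successors encode n, N >= 1. The equality is one of infima for every radius; attainment is
    claimed for positive radius, as it can fail at radius 0. *)
Theorem theorem1 (R : realType) (n N : nat) (nu : 'rV[R]_n.+1 -> R)
    (kappa eps : R) (z : 'I_N.+1 -> Xi R n.+1)
    (Hnu : is_norm nu) (Hkappa : 0 < kappa) (Heps : 0 <= eps) :
  let J := ereal_inf [set worst_case_loss nu kappa eps (empirical z) b |
                      b in [set: 'rV[R]_n.+1]] in
  J = ereal_inf [set (objective eps p)%:E | p in feasible nu kappa z] /\
  (0 < eps -> exists2 p, feasible nu kappa z p & J = (objective eps p)%:E).
Proof.
move=> J.
have JE : J = ereal_inf [set (objective eps p)%:E | p in feasible nu kappa z].
  apply/eqP; rewrite eq_le; apply/andP; split; apply: le_ereal_inf_tmp.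
    move=> _ [[[b lam] s] feas <-]; apply: ge_ereal_inf.
    exists (worst_case_loss nu kappa eps (empirical z) b); first by exists b.
    have [_ _ /(dual_normP Hnu) blam] := feas.
    apply: le_trans (worst_case_loss_le Hnu z eps (ltW Hkappa) blam) _.
    by rewrite lee_fin; exact: reduced_objective_le feas.
  move=> _ [b _ <-]; apply: ge_ereal_inf.
  have [lam blam le] := worst_case_loss_dual Hnu z Hkappa Heps b.
  exists (reduced_objective z kappa eps (b, lam))%:E => //.
  by exists (b, lam, fun i => robust_loss kappa lam b (z i)) => //; exact: reduced_feasible.
split=> // eps0.
have [[b lam] blam pmin] := reduced_objective_min Hnu z kappa eps0.
exists (b, lam, fun i => robust_loss kappa lam b (z i)).
  exact: reduced_feasible.
rewrite JE; apply/eqP; rewrite eq_le; apply/andP; split.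
  apply: ereal_inf_lbound.
  by exists (b, lam, fun i => robust_loss kappa lam b (z i)) => //; exact: reduced_feasible.
apply: le_ereal_inf_tmp => _ [[[b' lam'] s] feas <-]; rewrite lee_fin.
apply: (@le_trans _ _ (reduced_objective z kappa eps (b', lam'))).
  by apply: pmin; case: feas.
exact: reduced_objective_le feas.
Qed.
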